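(* Let $\mathcal V$ be a variety of lattice expansions generated by a finite set of finite algebras. Then: every basic operation of every algebra in $\mathcal V$ is smooth; for every $E\in\mathcal V$, the canonical extension of each basic operation of $E$ is continuous with respect to the interval topology (which equals the double Scott topology) on $E^\delta$ and its finite powers; canonical extension is functorial on $\mathcal V$, i.e. for every homomorphism $h:E\to E'$ in $\mathcal V$ the map $h^\delta$ is a homomorphism between the canonical extensions (with the extended operations), and $E\mapsto E^\delta$, $h\mapsto h^\delta$ is a functor; and each canonical extension $E^\delta$, $E\in\mathcal V$, is a Stone topological algebra in its interval (equivalently, double Scott) topology.
   Context: A lattice expansion is a bounded lattice with additional finitary operations; a homomorphism is a bounded lattice homomorphism commuting with the additional operations. A canonical extension of a lattice $L$ is a complete lattice $L^\delta$ with a lattice embedding $L\hookrightarrow L^\delta$ (identify $L$ with its image) satisfying Density (every element is a join of meets and a meet of joins of elements of $L$) and Compactness (if $\bigwedge S\le\bigvee T$ in $L^\delta$ for $S,T\subseteq L$, then $\bigwedge S'\le\bigvee T'$ for finite $S'\subseteq S,T'\subseteq T$). Filter elements are meets of subsets of $L$, ideal elements joins of subsets of $L$; $(L^n)^\delta=(L^\delta)^n$. For a map $f:L^n\to M$ and $u\in(L^\delta)^n$: $f^\sigma(u)=\bigvee\{\bigwedge f([x,y]\cap L^n)\mid x\le u\le y,\ x$ filter, $y$ ideal element$\}$ and $f^\pi(u)=\bigwedge\{\bigvee f([x,y]\cap L^n)\mid x\le u\le y\}$, computed in $M^\delta$. $f$ is smooth if $f^\sigma=f^\pi$, and then $f^\delta:=f^\sigma$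 is its canonical extension; the canonical extension of a lattice expansion $(E,(f_i))$ is $(E^\delta,(f_i^\delta))$; lattice homomorphisms $h$ are smooth with extension $h^\delta$. The interval topology on a poset is generated by complements of principal upsets and principal downsets; the double Scott topology is the join of the Scott topology and the dual Scott topology. A Stone topological algebra is an algebra with a topology making all basic operations continuous, whose underlying space is compact Hausdorff and zero-dimensional. *)

(* Defs.v *)
From HB Require Import structures.
From mathcomp Require Import all_boot all_order.
From mathcomp Require Import boolp classical_sets functions cardinality.
From mathcomp Require Import topology.

Set Implicit Arguments.
Unset Strict Implicit.
Unset Printing Implicit Defensive.

Import Order.TTheory.
Local Open Scope classical_set_scope.
Local Open Scope order_scope.

Record signature := Signature { sym : Type; arity : sym -> nat }.

(* [disp] is only a notational tag; carriers may be trivial (\bot = \top). *)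
Record latticeExpansion (S : signature) := LatticeExpansion {
  disp : Order.disp_t;
  carrier :> tbLatticeType disp;
  op : forall f : sym S, (arity f).-tuple carrier -> carrier
}.

Definition bounded_lattice_hom d (L : tbLatticeType d) d' (M : tbLatticeType d')
    (h : L -> M) : Prop :=
  [/\ Order.meet_morphism h, Order.join_morphism h, h \bot = \bot & h \top = \top].

Definition homomorphism (S : signature) (E E' : latticeExpansion S)
    (h : E -> E') : Prop :=
  bounded_lattice_hom h /\
  forall (f : sym S) (t : (arity f).-tuple E), h (op t) = op (map_tuple h t).

(* The basic operations of a lattice expansion as an algebra are the bounded
   lattice operations together with the additional ones. *)
Inductive basicSym (S : signature) :=
  | MeetSym | JoinSym | BotSym | TopSym | AddSym of sym S.
Arguments MeetSym {S}.
Arguments JoinSym {S}.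
Arguments BotSym {S}.
Arguments TopSym {S}.

Definition basic_arity (S : signature) (s : basicSym S) : nat :=
  match s with
  | MeetSym | JoinSym => 2
  | BotSym | TopSym => 0
  | AddSym f => arity f
  end.

Definition basic_op (S : signature) (E : latticeExpansion S) (s : basicSym S) :
    (basic_arity s).-tuple E -> E :=
  match s return (basic_arity s).-tuple E -> E with
  | MeetSym => fun t => tnth t ord0 `&` tnth t ord_max
  | JoinSym => fun t => tnth t ord0 `|` tnth t ord_max
  | BotSym => fun=> \bot
  | TopSym => fun=> \top
  | AddSym f => @op S E f
  end.

(* [P], with the maps [p i], is (isomorphic to) the direct product of the [A i]. *)
Definition is_product (S : signature) (I : Type) (A : I -> latticeExpansion S)
    (P : latticeExpansion S) (p : forall i, P -> A i) : Prop :=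
  (forall i, homomorphism (p i)) /\
  (forall a : forall i, A i, exists! x : P, forall i, p i x = a i).

(* Closure under homomorphic images, subalgebras and direct products (each up
   to isomorphism: an algebra is a subalgebra of [E] up to isomorphism iff it
   embeds in [E]). *)
Definition variety (S : signature) (C : latticeExpansion S -> Prop) : Prop :=
  [/\ forall (E E' : latticeExpansion S) (h : E -> E'),
        homomorphism h -> (forall y, exists x, h x = y) -> C E -> C E',
      forall (E E' : latticeExpansion S) (h : E' -> E),
        homomorphism h -> injective h -> C E -> C E' &
      forall (I : Type) (A : I -> latticeExpansion S) (P : latticeExpansion S)
        (p : forall i, P -> A i),
        is_product p -> (forall i, C (A i)) -> C P].

Definition generated_variety (S : signature) (I : Type)
    (K : I -> latticeExpansion S) (E : latticeExpansion S) : Prop :=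
  forall C : latticeExpansion S -> Prop,
    variety C -> (forall i, C (K i)) -> C E.

Definition complete_lattice d (L : latticeType d) : Prop :=
  forall A : set L, supremums A !=set0 /\ infimums A !=set0.

(* [supremum x0] and [infimum x0] return [x0] on the empty set. *)
Definition Join d (L : tbLatticeType d) (A : set L) : L := supremum \bot A.
Definition Meet d (L : tbLatticeType d) (A : set L) : L := infimum \top A.

Section FilterIdealElements.
Context {d d' : Order.disp_t} {L : tbLatticeType d} {C : tbLatticeType d'}.
Variable e : L -> C.

Definition filter_element : set C :=
  [set x | exists A : set L, infimums (e @` A) x].

Definition ideal_element : set C :=
  [set x | exists A : set L, supremums (e @` A) x].

Definition dense_embedding : Prop :=
  forall u : C,
    (exists2 F : set C, F `<=` filter_element & supremums F u) /\
    (exists2 G : set C, G `<=` ideal_element & infimums G u).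

Definition compact_embedding : Prop :=
  forall A B : set L, Meet (e @` A) <= Join (e @` B) ->
    exists A' B' : set L,
      [/\ A' `<=` A, finite_set A', B' `<=` B, finite_set B' &
          Meet (e @` A') <= Join (e @` B')].

End FilterIdealElements.

Record canonicalExtension d (L : tbLatticeType d) := CanonicalExtension {
  ce_disp : Order.disp_t;
  ce_lattice :> tbLatticeType ce_disp;
  ce_complete : complete_lattice ce_lattice;
  ce_emb : L -> ce_lattice;
  ce_emb_hom : bounded_lattice_hom ce_emb;
  ce_emb_inj : injective ce_emb;
  ce_dense : dense_embedding ce_emb;
  ce_compact : compact_embedding ce_emb
}.

(* The extensions of a map [f : L -> M], for [L] sitting in [C] along [e] and
   [M] sitting in [D] along [e']. *)
Section Extensions.
Context {d1 d2 d3 d4 : Order.disp_t}.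
Context {L : tbLatticeType d1} {C : tbLatticeType d2}.
Context {M : tbLatticeType d3} {D : tbLatticeType d4}.
Variables (e : L -> C) (e' : M -> D) (f : L -> M).

Definition interval_image (x y : C) : set D :=
  [set e' (f a) | a in [set a | x <= e a <= y]].

Definition sigma_ext (u : C) : D :=
  Join [set Meet (interval_image xy.1 xy.2) | xy in
    [set xy : C * C | [/\ filter_element e xy.1, ideal_element e xy.2 &
                          xy.1 <= u <= xy.2]]].

Definition pi_ext (u : C) : D :=
  Meet [set Join (interval_image xy.1 xy.2) | xy in
    [set xy : C * C | [/\ filter_element e xy.1, ideal_element e xy.2 &
                          xy.1 <= u <= xy.2]]].

Definition smooth : Prop := sigma_ext =1 pi_ext.

End Extensions.

(* The n-th power of a canonical extension, (L^n)^delta = (L^delta)^n, with the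
   coordinatewise embedding and order. *)
Definition power_emb d (L : tbLatticeType d) (X : canonicalExtension L) (n : nat) :
    n.-tupleprod L -> n.-tupleprod X :=
  map_tuple (@ce_emb d L X).
Arguments power_emb {d L} X n.

Section OperationExtensions.
Context {d : Order.disp_t} {L : tbLatticeType d}.
Variables (X : canonicalExtension L) (n : nat) (f : n.-tuple L -> L).

Definition smooth_op : Prop := smooth (power_emb X n) (@ce_emb d L X) f.

(* Defined as f^sigma for every [f], smooth or not. *)
Definition delta_op : n.-tupleprod X -> X :=
  sigma_ext (power_emb X n) (@ce_emb d L X) f.

End OperationExtensions.
Arguments delta_op {d L} X {n} f u.

Definition delta_map d (L : tbLatticeType d) d' (L' : tbLatticeType d')
    (X : canonicalExtension L) (X' : canonicalExtension L') (h : L -> L') :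
    X -> X' :=
  sigma_ext (@ce_emb d L X) (@ce_emb d' L' X') h.
Arguments delta_map {d L d' L'} X X' h u.

Definition canext (S : signature) (E : latticeExpansion S)
    (X : canonicalExtension E) : latticeExpansion S :=
  @LatticeExpansion S (ce_disp X) X (fun f => delta_op X (@op S E f)).

(* The space on [T] whose topology has subbase [B]. *)
Definition generated_space (T : choiceType) (B : set (set T)) : Type := T.
HB.instance Definition _ (T : choiceType) (B : set (set T)) :=
  Choice.copy (generated_space B) T.
HB.instance Definition _ (T : choiceType) (B : set (set T)) :=
  isSubBaseTopological.Build (generated_space B) B id.

Section OrderTopologies.
Context {d : Order.disp_t}.

Definition interval_subbase (T : porderType d) : set (set T) :=
  [set U | exists a : T, U = ~` [set x | a <= x] \/ U = ~` [set x | x <= a]].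

Definition directed (T : porderType d) (A : set T) : Prop :=
  A !=set0 /\
  forall x y, A x -> A y -> exists z, [/\ A z, x <= z & y <= z].

End OrderTopologies.

Definition scott_open d (T : porderType d) : set (set T) :=
  [set U | (forall x y, x <= y -> U x -> U y) /\
    forall (A : set T) (s : T), directed A -> supremums A s -> U s ->
      A `&` U !=set0].

Definition dual_scott_open d (T : porderType d) : set (set T) :=
  @scott_open _ T^d.

Definition interval_space d (T : porderType d) : Type :=
  generated_space (@interval_subbase d T).
HB.instance Definition _ d (T : porderType d) :=
  Topological.copy (interval_space T) (generated_space (@interval_subbase d T)).

Definition double_scott_space d (T : porderType d) : Type :=
  generated_space (@scott_open d T `|` @dual_scott_open d T).
HB.instance Definition _ d (T : porderType d) :=
  Topological.copy (double_scott_space T)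
    (generated_space (@scott_open d T `|` @dual_scott_open d T)).

Definition interval_opens d (T : porderType d) : set (set T) :=
  @open (interval_space T).
Arguments interval_opens {d} T _.

Definition double_scott_opens d (T : porderType d) : set (set T) :=
  @open (double_scott_space T).
Arguments double_scott_opens {d} T _.

Definition interval_continuous d (T : porderType d) d' (T' : porderType d')
    (f : T -> T') : Prop :=
  continuous (f : interval_space T -> interval_space T').

(* A base of clopen sets; the library's [zero_dimensional] only asks that
   distinct points be separated by clopen sets. *)
Definition has_clopen_base (T : topologicalType) : Prop := basis (@clopen T).

Definition stone_topological_algebra (T : topologicalType) (I : Type)
    (ar : I -> nat) (o : forall i, (ar i).-tuple T -> T) : Prop :=
  [/\ compact [set: T], hausdorff_space T, has_clopen_base T &
      forall i, continuous
        (fun v : prod_topology (fun _ : 'I_(ar i) => T) =>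
           o i [tuple v j | j < ar i])].

(* Main.v *)
(* Let N bound the size of the generating algebras. Having enough congruences
   with at most N classes to separate points is inherited by subalgebras and
   products, and by Jonsson's argument also by homomorphic images: lattices have
   a median polynomial, so a congruence maximal for separating a filter from an
   ideal is meet-prime, and the meet of all the congruences that identify one of
   the finitely many pairs of an (N+1)-element list is trivial, so that one
   of these pairs is identified by the maximal congruence. Hence in every E of
   the variety disjoint filters and ideals are separated by congruences with at
   most N classes.
   Each such congruence R cuts the canonical extension X into the finitely many
   disjoint intervals [/\c, \/c], for c a class of R. By density, compactness
   and the separation property these partitions separate the points of X and its
   order, and both f^sigma and f^pi map the block of a class c into the block of
   f(c). So f^sigma = f^pi, identities are checked block by block, and since
   blocks are clopen in the interval topology, all continuity and separation
   properties follow. *)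
Require Import Defs.
From HB Require Import structures.
From mathcomp Require Import all_boot all_order.
From mathcomp Require Import boolp classical_sets functions cardinality.
From mathcomp Require Import topology.

Set Implicit Arguments.
Unset Strict Implicit.
Unset Printing Implicit Defensive.

Import Order.TTheory.
Local Open Scope classical_set_scope.
Local Open Scope order_scope.

(** * Congruences and the distributivity of their lattice *)

Record congruence (S : signature) (E : latticeExpansion S)
    (R : E -> E -> Prop) : Prop := Congruence {
  con_refl : forall x, R x x;
  con_sym : forall x y, R x y -> R y x;
  con_trans : forall x y z, R x y -> R y z -> R x z;
  con_op : forall (s : basicSym S) (t t' : (basic_arity s).-tuple E),
    (forall j, R (tnth t j) (tnth t' j)) -> R (basic_op t) (basic_op t')
}.

(* With at most [N] classes; this form passes to restrictions along
   homomorphisms and needs no choice of representatives. *)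
Definition index_le (N : nat) T (R : T -> T -> Prop) : Prop :=
  forall s : 'I_N.+1 -> T, exists i j, i != j /\ R (s i) (s j).

(** The order of the quotient by [R], written in [L] itself so that no quotient has to be formed. *)
Definition le_mod d (L : latticeType d) (R : L -> L -> Prop) (x y : L) : Prop :=
  R (x `&` y) x.

Definition tuple_upd n T (t : n.-tuple T) (j : 'I_n) (x : T) : n.-tuple T :=
  [tuple if i == j then x else tnth t i | i < n].

Section CongruenceTheory.
Variables (S : signature) (E : latticeExpansion S).
Implicit Types R : E -> E -> Prop.

(** By transitivity the arguments may be exchanged one at a time. This form suits joins and unions
    of congruences, where different arguments may be related for different reasons. *)
Lemma con_unary R :
  (forall x, R x x) -> (forall x y, R x y -> R y x) ->
  (forall x y z, R x y -> R y z -> R x z) ->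
  (forall (s : basicSym S) (t : (basic_arity s).-tuple E) j x y, R x y ->
     R (basic_op (tuple_upd t j x)) (basic_op (tuple_upd t j y))) ->
  congruence R.
Proof.
move=> Rr Rs Rt Rop; split=> // s t t' tt'.
(* The first [k] entries come from [t'], the others from [t]. *)
pose mix k : (basic_arity s).-tuple E :=
  [tuple if (i < k)%N then tnth t' i else tnth t i | i < basic_arity s].
suff H k : (k <= basic_arity s)%N -> R (basic_op t) (basic_op (mix k)).
  suff <- : mix (basic_arity s) = t' by exact: H.
  by apply: eq_from_tnth => i; rewrite tnth_mktuple ltn_ord.
elim: k => [_|k IH lek].
  suff -> : mix 0 = t by [].
  by apply: eq_from_tnth => i; rewrite tnth_mktuple.
apply: Rt (IH (ltnW lek)) _; pose j := Ordinal lek.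
have -> : mix k = tuple_upd (mix k) j (tnth t j).
  apply: eq_from_tnth => i; rewrite !tnth_mktuple; case: eqP => // ->.
  by rewrite ltnn.
have -> : mix k.+1 = tuple_upd (mix k) j (tnth t' j).
  apply: eq_from_tnth => i; rewrite !tnth_mktuple ltnS leq_eqVlt.
  rewrite -(inj_eq val_inj) /=; case: eqP => // ik.
  by congr (tnth t' _); apply: val_inj.
exact: Rop.
Qed.

Lemma con_upd R (cR : congruence R) (s : basicSym S)
    (t : (basic_arity s).-tuple E) j x y :
  R x y -> R (basic_op (tuple_upd t j x)) (basic_op (tuple_upd t j y)).
Proof.
move=> Rxy; apply: (con_op cR) => i; rewrite !tnth_mktuple.
by case: eqP => // _; apply: con_refl cR _.
Qed.

Lemma con_meet R (cR : congruence R) x y x' y' :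
  R x x' -> R y y' -> R (x `&` y) (x' `&` y').
Proof.
move=> Rx Ry; apply: (con_op cR (s := MeetSym) (t := [tuple x; y])
  (t' := [tuple x'; y'])) => j.
by rewrite !(tnth_nth \bot); case: j => -[|[|[]]].
Qed.

Lemma con_join R (cR : congruence R) x y x' y' :
  R x x' -> R y y' -> R (x `|` y) (x' `|` y').
Proof.
move=> Rx Ry; apply: (con_op cR (s := JoinSym) (t := [tuple x; y])
  (t' := [tuple x'; y'])) => j.
by rewrite !(tnth_nth \bot); case: j => -[|[|[]]].
Qed.

Lemma con_le_mod R (cR : congruence R) x y : x <= y -> le_mod R x y.
Proof. by move=> /meet_idPl xy; rewrite /le_mod xy; apply: con_refl cR _. Qed.

Lemma con_le_modW R (cR : congruence R) x y : R x y -> le_mod R x y.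
Proof.
move=> Rxy; rewrite /le_mod -[X in R _ X]meetxx.
by apply: con_meet => //; [exact: con_refl cR _ | exact: con_sym cR _ _ _].
Qed.

Lemma le_mod_trans R (cR : congruence R) y x z :
  le_mod R x y -> le_mod R y z -> le_mod R x z.
Proof.
rewrite /le_mod => xy yz.
have h : R (x `&` z) (x `&` y `&` z).
  apply: con_meet => //; first exact: con_sym cR _ _ xy.
  exact: con_refl cR _.
apply: (con_trans cR h); rewrite -meetA.
apply: (con_trans cR _ xy); apply: con_meet => //; exact: con_refl cR _.
Qed.

Lemma le_mod_antisym R (cR : congruence R) x y :
  le_mod R x y -> le_mod R y x -> R x y.
Proof.
rewrite /le_mod => xy yx; apply: (con_trans cR (con_sym cR xy)).
by rewrite meetC.
Qed.

Lemma le_mod_join R (cR : congruence R) x y : le_mod R x y <-> R (x `|` y) y.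
Proof.
split=> h.
  have := con_join cR h (con_refl cR y).
  by rewrite meetC meetUKC => /(con_sym cR).
have := con_meet cR (con_refl cR x) h.
by rewrite joinKI => /(con_sym cR).
Qed.

Lemma le_mod_meet R (cR : congruence R) x y z :
  le_mod R z x -> le_mod R z y -> le_mod R z (x `&` y).
Proof.
rewrite /le_mod => zx zy; rewrite meetA.
exact: (con_trans cR (con_meet cR zx (con_refl cR y)) zy).
Qed.

Lemma le_mod_lub R (cR : congruence R) x y z :
  le_mod R x z -> le_mod R y z -> le_mod R (x `|` y) z.
Proof.
move=> /(le_mod_join cR) xz /(le_mod_join cR) yz.
apply/(le_mod_join cR); rewrite -joinA.
exact: (con_trans cR (con_join cR (con_refl cR x) yz) xz).
Qed.

(** For congruences [A] and [B], this is their join in the congruence lattice. *)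
Inductive con_chain (A B : E -> E -> Prop) : E -> E -> Prop :=
| chain_refl x : con_chain A B x x
| chain_step x y z : A x y \/ B x y -> con_chain A B y z -> con_chain A B x z.

Lemma chain_trans A B x y z :
  con_chain A B x y -> con_chain A B y z -> con_chain A B x z.
Proof. by move=> c; elim: c z => // ? ? ? ? ? IH ? /IH; apply: chain_step. Qed.

(** Applying an operation in one varying argument carries a chain to a chain, link by link. *)
Lemma chain_con A B (cA : congruence A) (cB : congruence B) :
  congruence (con_chain A B).
Proof.
apply: con_unary; [exact: chain_refl | | exact: chain_trans |].
  move=> x y; elim=> [{}x|{}x {}y z xy _ IH]; first exact: chain_refl.
  apply: chain_trans IH _; apply: chain_step (chain_refl _ _ _).
  by case: xy => h; [left; apply: con_sym h|right; apply: con_sym h].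
move=> s t j x y; elim=> [{}x|{}x {}y z xy _ IH]; first exact: chain_refl.
apply: chain_step IH.
by case: xy => h; [left|right]; apply: con_upd.
Qed.

(** A majority polynomial: two equal arguments determine the value. *)
Let med (p q z : E) : E := (p `&` q) `|` (p `&` z) `|` (q `&` z).

Let med_left p q : med p q p = p.
Proof. by rewrite /med meetxx meetUKC meetKUC. Qed.

Let med_right p q : med p q q = q.
Proof. by rewrite /med meetxx joinxx meetUK. Qed.

Let med_diag p z : med p p z = p.
Proof. by rewrite /med meetxx !meetKU. Qed.

(* Jonsson's argument: the median polynomial projects a chain from [x] to [y]
   into the class of [x] modulo [A]. *)
Lemma con_chain_distr A B C D (cA : congruence A) (cB : congruence B)
    (cC : congruence C) (cD : congruence D) :
  (forall x y, A x y -> B x y -> D x y) ->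
  (forall x y, A x y -> C x y -> D x y) ->
  forall x y, A x y -> con_chain B C x y -> D x y.
Proof.
move=> ABD ACD x y Axy BCxy.
have Am z w : A (med x y z) (med x y w).
  suff H v : A x (med x y v) by apply: con_trans (H w) => //; apply: con_sym.
  have r := con_refl cA; rewrite -{1}[x](med_diag x v) /med.
  have h p q : A p q -> A (x `&` p) (y `&` q) by exact: con_meet.
  apply: con_join (h _ _ (r v)) => //; apply: con_join => //.
  exact: con_meet.
have Rm R z w (cR : congruence R) : R z w -> R (med x y z) (med x y w).
  have r := con_refl cR; move=> zw.
  by apply: con_join => //; [apply: con_join => //|]; apply: con_meet.
(* Every link of the chain is sent to a pair in [A] by [Am] and in [B] or [C] by [Rm], hence in [D];
   the ends [x] and [y] are fixed. *)
suff H z w : con_chain B C z w -> D (med x y z) (med x y w).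
  by have := H _ _ BCxy; rewrite med_left med_right.
elim=> [{}z|{}z {}w v zw _ IH]; first exact: con_refl.
apply: con_trans IH => //.
by case: zw => /Rm h; [apply: ABD|apply: ACD] => //; apply: h.
Qed.

End CongruenceTheory.

(** * Separating a filter from an ideal by congruences of bounded index *)

Definition residually_index_le (N : nat) (S : signature)
    (E : latticeExpansion S) : Prop :=
  forall x y : E,
    (forall R, congruence R -> index_le N R -> R x y) -> x = y.

Definition separates_mod d (L : latticeType d) (F I : set L)
    (R : L -> L -> Prop) : Prop :=
  forall a b, F a -> I b -> ~ le_mod R a b.

Section SeparatingCongruences.
Variables (S : signature) (E : latticeExpansion S).
Variables (F I : set E).
Hypothesis FI : forall x y, F x -> F y -> F (x `&` y).
Hypothesis IU : forall x y, I x -> I y -> I (x `|` y).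

(** Zorn's lemma: separation and each congruence condition involve only a few pairs, so they survive
    unions of chains. *)
Lemma maximal_separating (K : E -> E -> Prop) :
  congruence K -> separates_mod F I K ->
  exists M, [/\ congruence M, separates_mod F I M, forall x y, K x y -> M x y &
    forall M', congruence M' -> separates_mod F I M' ->
      (forall x y, M x y -> M' x y) -> forall x y, M' x y -> M x y].
Proof.
(* The order is on sets of pairs added to [K]; thus the union of the empty chain yields [K], which
   is admissible. *)
move=> cK sK; pose ext (A : set (E * E)) x y := K x y \/ A (x, y).
pose P : set (set (E * E)) :=
  [set A | congruence (ext A) /\ separates_mod F I (ext A)].
have extS A B x y : A `<=` B -> ext A x y -> ext B x y.
  by move=> AB [|/AB]; [left|right].
have [D DP Dtot|A [[cA sA] Amax]] := @Zorn_bigcup _ P.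
  set U := \bigcup_(X in D) X.
  have extU X x y : D X -> ext X x y -> ext U x y.
    by move=> DX; apply: extS; apply: bigcup_sup.
  have extUP x y : ext U x y -> K x y \/ exists X, D X /\ ext X x y.
    by case=> [|[X DX Xxy]]; [left|right; exists X; split=> //; right].
  split; last first.
    move=> a b Fa Ib /extUP [|[X [DX]]]; first exact: sK.
    by have [_] := DP _ DX; apply.
  apply: con_unary.
  - by move=> x; left; apply: con_refl cK _.
  - move=> x y /extUP [|[X [DX]]]; first by left; apply: con_sym.
    by move=> h; apply: (extU _ _ _ DX); apply: con_sym (DP _ DX).1 _ _ h.
  - move=> x y z /extUP xy /extUP yz.
    case: xy yz => [xy|[X [DX xy]]] [yz|[Y [DY yz]]].
    + by left; apply: con_trans xy yz.
    + by apply: (extU _ _ _ DY); apply: con_trans (DP _ DY).1 _ _ _ _ yz; left.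
    + by apply: (extU _ _ _ DX); apply: con_trans (DP _ DX).1 _ _ _ xy _; left.
    + have [XY|YX] := Dtot _ _ DX DY.
        apply: (extU _ _ _ DY); apply: con_trans (DP _ DY).1 _ _ _ _ yz.
        exact: extS XY xy.
      apply: (extU _ _ _ DX); apply: con_trans (DP _ DX).1 _ _ _ xy _.
      exact: extS YX yz.
  - move=> s t j x y /extUP [|[X [DX]]]; first by left; apply: con_upd.
    by move=> h; apply: (extU _ _ _ DX); apply: con_upd (DP _ DX).1 _ _ _ _ _ h.
exists (ext A); split=> //; first by left.
move=> M' cM' sM' AM' x y M'xy; right; apply: contrapT => nA.
apply: (Amax [set p | M' p.1 p.2]).
  split; first by move=> [u v] Auv; apply: AM'; right.
  by move/(_ (x, y) M'xy).
suff eM : ext [set p | M' p.1 p.2] = M' by rewrite /P /= eM.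
apply/funext => u; apply/funext => v; apply/propext; split; last by right.
by case=> //= Kuv; apply: AM'; left.
Qed.

(** If neither [A] nor [B] is below [M], maximality gives [a <= b] modulo the join of [M] and [A],
    and [a' <= b'] modulo the join of [M] and [B]. Then [a & a'] is below [b | b'] modulo both
    joins, hence modulo [M] by distributivity, against separation. *)
Lemma maximal_separating_prime (M : E -> E -> Prop) :
  congruence M -> separates_mod F I M ->
  (forall M', congruence M' -> separates_mod F I M' ->
      (forall x y, M x y -> M' x y) -> forall x y, M' x y -> M x y) ->
  forall A B, congruence A -> congruence B ->
    (forall x y, A x y -> B x y -> M x y) ->
    (forall x y, A x y -> M x y) \/ (forall x y, B x y -> M x y).
Proof.
move=> cM sM Mmax A B cA cB ABM.
have join_sep C : congruence C -> ~ (forall x y, C x y -> M x y) ->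
    exists a b, [/\ F a, I b & le_mod (con_chain M C) a b].
  move=> cC nC; apply: contrapT => h; apply: nC => x y Cxy.
  apply: (Mmax (con_chain M C)) => //.
  - exact: chain_con.
  - by move=> a b Fa Ib ab; apply: h; exists a, b.
  - by move=> u v uv; apply: chain_step (chain_refl _ _ _); left.
  - by apply: chain_step (chain_refl _ _ _); right.
apply: contrapT => /not_orP [nA nB].
have [a [b [Fa Ib ab]]] := join_sep _ cA nA.
have [a' [b' [Fa' Ib' ab']]] := join_sep _ cB nB.
have cMA := chain_con cM cA; have cMB := chain_con cM cB.
have mono C : congruence C -> forall u u' v v',
    u' <= u -> v <= v' -> le_mod C u v -> le_mod C u' v'.
  move=> cC u u' v v' /(con_le_mod cC) uu /(con_le_mod cC) vv uv.
  exact: le_mod_trans (le_mod_trans _ uu uv) vv.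
apply: (sM _ _ (FI Fa Fa') (IU Ib Ib')).
(* Distributivity is used twice: [A] meets the join of [M] and [B] inside [M], and therefore the two
   joins meet inside [M]. *)
apply: (con_chain_distr cMB cM cA cM) => //.
- by move=> x y BMxy Axy; apply: (con_chain_distr cA cM cB cM _ _ Axy BMxy).
- by apply: mono ab' => //; rewrite ?leIr ?leUr.
- by apply: mono ab => //; rewrite ?leIl ?leUl.
Qed.

(* With R_ij the meet of all bounded congruences identifying [s i] and [s j],
   the finite meet of the R_ij (i <> j) is equality, hence below the maximal
   congruence [M]; as [M] is meet-prime, some R_ij is below [M]. *)
Lemma separating_index_le (N : nat) (K : E -> E -> Prop) :
  residually_index_le N E -> F !=set0 -> I !=set0 ->
  congruence K -> separates_mod F I K ->
  exists M, [/\ congruence M, index_le N M, separates_mod F I M &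
    forall x y, K x y -> M x y].
Proof.
move=> resE [a0 Fa0] [b0 Ib0] cK sK.
have [M [cM sM KM Mmax]] := maximal_separating cK sK.
exists M; split=> // s.
(* The meet, over the pairs in [l], of the congruences R_ij. For empty [l] it is the full relation,
   which is not below [M] because [F] and [I] are inhabited. *)
pose meetc (l : seq ('I_N.+1 * 'I_N.+1)) x y :=
  forall R, congruence R -> index_le N R ->
    (exists2 p, p \in l & R (s p.1) (s p.2)) -> R x y.
have cmeetc l : congruence (meetc l).
  split.
  - by move=> x R cR _ _; apply: con_refl cR _.
  - by move=> x y xy R cR iR h; apply: con_sym (xy R cR iR h).
  - by move=> x y z xy yz R cR iR h; apply: con_trans (xy R cR iR h) (yz R cR iR h).
  - by move=> f t t' tt' R cR iR h; apply: (con_op cR) => j; apply: tt'.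
have main l : (forall x y, meetc l x y -> M x y) ->
    exists2 p, p \in l & M (s p.1) (s p.2).
  elim: l => [|p l IH] lM.
    by case: (sM _ _ Fa0 Ib0); apply: lM => R _ _ [].
  have [|pM|/IH [q ql Mq]] :=
    maximal_separating_prime cM sM Mmax (cmeetc [:: p]) (cmeetc l).
  - move=> x y px lx; apply: lM => R cR iR [q]; rewrite inE => /orP[/eqP ->|ql] Rq.
      by apply: px => //; exists p; rewrite ?mem_head.
    by apply: lx => //; exists q.
  - exists p; first exact: mem_head.
    by apply: pM => R _ _ [q]; rewrite inE => /eqP ->.
  - by exists q => //; rewrite inE ql orbT.
have [|[i j] /=] := main [seq p <- enum {: 'I_N.+1 * 'I_N.+1} | p.1 != p.2]; last first.
  by rewrite mem_filter => /andP [ij _] Mij; exists i, j.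
move=> x y lxy; suff -> : x = y by apply: con_refl cM _.
(* Pigeonhole: each bounded congruence identifies some pair of distinct positions of [s], so it
   takes part in the meet. *)
apply: resE => R cR iR; apply: lxy => //.
have [i [j [ij Rij]]] := iR s.
by exists (i, j) => //; rewrite mem_filter ij mem_enum.
Qed.

End SeparatingCongruences.

Lemma lattice_hom_le d (L : tbLatticeType d) d' (M : tbLatticeType d')
    (h : L -> M) x y : bounded_lattice_hom h -> x <= y -> h x <= h y.
Proof. by case=> hI _ _ _ /meet_idPl xy; apply/meet_idPl; rewrite -hI xy. Qed.

(** * Residual bounds throughout a variety *)

Section Variety.
Variable S : signature.
Implicit Types E : latticeExpansion S.

Lemma hom_basic_op E E' (h : E -> E') (s : basicSym S)
    (t : (basic_arity s).-tuple E) :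
  homomorphism h -> h (basic_op t) = basic_op (map_tuple h t).
Proof.
by case=> -[hI hU h0 h1] hop; case: s t => [||||f] t //=; rewrite ?hI ?hU ?tnth_map.
Qed.

Lemma con_preim E E' (h : E -> E') (R : E' -> E' -> Prop) :
  homomorphism h -> congruence R -> congruence (fun x y => R (h x) (h y)).
Proof.
move=> hh cR; split=> [x|x y|x y z|s t t' tt'].
- exact: con_refl cR _.
- exact: con_sym cR _ _.
- exact: con_trans cR _ _ _.
- by rewrite !hom_basic_op //; apply: (con_op cR) => j; rewrite !tnth_map.
Qed.

Lemma index_le_preim N T T' (h : T -> T') (R : T' -> T' -> Prop) :
  index_le N R -> index_le N (fun x y => R (h x) (h y)).
Proof. by move=> iR s; have := iR (h \o s). Qed.

Lemma congruence_eq E : congruence (@eq E).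
Proof.
split=> // [x y z -> //|s t t' tt'].
by congr basic_op; apply: eq_from_tnth.
Qed.

Lemma index_le_eq (T : Type) n N :
  (@setT T #<= `I_n)%card -> (n <= N)%N -> index_le N (@eq T).
Proof.
move=> /pcard_leP [f] nN s; apply: contrapT => h.
have fN x : (f x < N)%N by apply: leq_trans nN; have := @funS _ _ _ _ f x I.
have /leq_card : injective (fun i => Ordinal (fN (s i))).
  move=> i j [fij]; apply: contrapT => /eqP ij; apply: h; exists i, j; split=> //.
  by apply: (@inj _ _ _ f); rewrite ?inE.
by rewrite !card_ord ltnn.
Qed.

(** For subalgebras and products, bounded congruences are pulled back. For an image under [h] with
    [h a] not below [h b], the filter of elements sent above [h a] and the ideal of those sent below
    [h b] are separated modulo the kernel of [h]; a bounded separating congruence containing the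
    kernel then descends. *)
Lemma variety_residually_index_le N : variety (@residually_index_le N S).
Proof.
split.
- move=> E E' h hh hsurj resE.
  have hm := hh.1.
  suff le (x y : E') : (forall R, congruence R -> index_le N R -> R x y) -> x <= y.
    move=> x y xy; apply/le_anti/andP; split; apply: le => // R cR iR.
    by apply: con_sym (xy R cR iR).
  move=> xy; have [a ax] := hsurj x; have [b bx] := hsurj y; subst x y.
  apply: contrapT => nab.
  pose K u v := h u = h v.
  have cK : congruence K by exact: con_preim hh (congruence_eq E').
  have [hI hU _ _] := hm.
  pose F := [set u | h a <= h u]; pose I := [set u | h u <= h b].
  have FI u v : F u -> F v -> F (u `&` v).
    by rewrite /F /= hI lexI => -> ->.
  have IU u v : I u -> I v -> I (u `|` v).
    by rewrite /I /= hU leUx => -> ->.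
  have sK : separates_mod F I K.
    move=> u v /= au vb; rewrite /le_mod /K hI => /meet_idPl uv.
    exact/nab/(le_trans au)/(le_trans uv).
  have [||M [cM iM sM KM]] := separating_index_le FI IU resE _ _ cK sK.
  + by exists a; rewrite /F /=.
  + by exists b; rewrite /I /=.
  (* The image of [M] under [h]; as [M] contains the kernel of [h], it can be tested on any
     preimages, which is [M'P]. *)
  pose M' u v := exists u' v', [/\ h u' = u, h v' = v & M u' v'].
  have M'P u v : M' (h u) (h v) -> M u v.
    move=> [u' [v' [/KM uu /KM vv uv]]].
    by apply: con_trans (con_sym cM uu) _ => //; apply: con_trans uv vv.
  have M'h u v : M u v -> M' (h u) (h v) by exists u, v.
  apply: (sM a b); rewrite /F /I //=.
  apply: (con_le_modW cM); apply: (M'P a b); apply: xy.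
    split.
    + by move=> u; have [u' <-] := hsurj u; exact: M'h (con_refl cM _).
    + by move=> _ _ [u [v [<- <- uv]]]; exact: M'h (con_sym cM uv).
    + move=> u v w; have [u' <-] := hsurj u; have [v' <-] := hsurj v.
      have [w' <-] := hsurj w; move=> /M'P uv /M'P vw.
      exact: M'h (con_trans cM uv vw).
    + move=> s t t' tt'.
      have [g gK] := choice hsurj.
      have tE (t0 : (basic_arity s).-tuple E') : map_tuple h (map_tuple g t0) = t0.
        by apply: eq_from_tnth => i; rewrite !tnth_map gK.
      rewrite -(tE t) -(tE t') -!(hom_basic_op _ hh); apply: M'h.
      apply: (con_op cM) => j.
      by apply: M'P; rewrite !tnth_map !gK.
  move=> s; have [g gK] := choice hsurj.
  have [i [j [ij Mij]]] := iM (g \o s); exists i, j; split=> //.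
  by rewrite -(gK (s i)) -(gK (s j)); apply: M'h.
- move=> E E' h hh hinj resE x y xy; apply: (hinj); apply: (resE) => R cR iR.
  exact: (xy (fun u v => R (h u) (h v)) (con_preim hh cR) (index_le_preim h iR)).
- move=> I A P p [ph pu] resA x y xy.
  have [z [_ zu]] := pu (p^~ x); rewrite -(zu x) // -(zu y) // => i.
  apply: (resA) => R cR iR; apply: (con_sym cR).
  exact: (xy (fun u v => R (p i u) (p i v)) (con_preim (ph i) cR)
    (index_le_preim (p i) iR)).
Qed.

(** On a generator, equality itself has at most [N] classes, with [N] the largest of the finitely
    many size bounds. *)
Lemma generated_residually_index_le (k : nat) (K : 'I_k -> latticeExpansion S) :
  (forall i, finite_set (@setT (K i))) ->
  exists N, forall E, generated_variety K E -> residually_index_le N E.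
Proof.
move=> finK.
have /choice [n Kn] i : exists n, (@setT (K i) #<= `I_n)%card.
  by apply/finite_set_leP/finK.
exists (\max_(i < k) n i)%N => E; apply; first exact: variety_residually_index_le.
move=> i x y; apply; first exact: congruence_eq.
exact: index_le_eq (Kn i) (leq_bigmax _).
Qed.

End Variety.

(** * Complete lattices, and filter and ideal elements of canonical extensions *)

Section CompleteLattice.
Context {d : Order.disp_t} {L : tbLatticeType d}.
Hypothesis cL : complete_lattice L.
Implicit Types (A : set L) (x z : L).

Lemma supremums_Join A : supremums A (Join A).
Proof.
(* On the empty set the default value [\bot] is the true supremum. *)
rewrite /Join /supremum; case: eqP => [->|_]; first by split=> // x _; rewrite le0x.
by have [[x Ax] _] := cL A; apply: xgetPex; exists x.
Qed.

Lemma infimums_Meet A : infimums A (Meet A).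
Proof.
rewrite /Meet /infimum; case: eqP => [->|_]; first by split=> // x _; rewrite lex1.
by have [_ [x Ax]] := cL A; apply: xgetPex; exists x.
Qed.

Lemma Join_ub A x : A x -> x <= Join A.
Proof. exact: (supremums_Join A).1. Qed.

Lemma Join_lub A z : (forall x, A x -> x <= z) -> Join A <= z.
Proof. exact: (supremums_Join A).2. Qed.

Lemma Meet_lb A x : A x -> Meet A <= x.
Proof. exact: (infimums_Meet A).1. Qed.

Lemma Meet_glb A z : (forall x, A x -> z <= x) -> z <= Meet A.
Proof. exact: (infimums_Meet A).2. Qed.

End CompleteLattice.

Lemma supremums_eq d (L : porderType d) (A : set L) x y :
  supremums A x -> supremums A y -> x = y.
Proof. exact: is_subset1_supremums. Qed.

Lemma infimums_eq d (L : porderType d) (A : set L) x y :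
  infimums A x -> infimums A y -> x = y.
Proof. exact: is_subset1_infimums. Qed.

Lemma finite_lower_bound d (L : tbLatticeType d) (A A' : set L) :
  (forall x y, A x -> A y -> A (x `&` y)) -> A !=set0 ->
  finite_set A' -> A' `<=` A -> exists2 a, A a & forall x, A' x -> a <= x.
Proof.
move=> AI [a0 Aa0] /finite_seqP [s ->].
elim: s => [|b s IH] sA; first by exists a0.
have [|a Aa alb] := IH; first by move=> x xs; apply: sA; rewrite /= inE xs orbT.
exists (a `&` b); first by apply: AI => //; apply: sA; rewrite /= mem_head.
move=> x /=; rewrite inE => /orP [/eqP ->|xs]; first exact: leIr.
by apply: le_trans (leIl _ _) _; apply: alb.
Qed.

Lemma finite_upper_bound d (L : tbLatticeType d) (A A' : set L) :
  (forall x y, A x -> A y -> A (x `|` y)) -> A !=set0 ->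
  finite_set A' -> A' `<=` A -> exists2 a, A a & forall x, A' x -> x <= a.
Proof. exact: (@finite_lower_bound _ L^d). Qed.

Section CanonicalExtension.
Context {d : Order.disp_t} {L : tbLatticeType d}.
Variable X : canonicalExtension L.
Let e : L -> X := @ce_emb d L X.
Let cX := @ce_complete _ _ X.
Let ehom : bounded_lattice_hom e := ce_emb_hom X.

Lemma ce_emb_le a b : (e a <= e b) = (a <= b).
Proof.
have [eI _ _ _] := ehom.
apply/idP/idP; last exact/lattice_hom_le/(ce_emb_hom X).
move=> /meet_idPl ab; apply/meet_idPl; apply: (@ce_emb_inj _ _ X).
by rewrite -/e eI.
Qed.

(** Closure under meets, respectively joins, replaces the finite sets given by compactness with
    single elements. *)
Lemma ce_compact_directed (A B : set L) :
  (forall x y, A x -> A y -> A (x `&` y)) -> A !=set0 ->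
  (forall x y, B x -> B y -> B (x `|` y)) -> B !=set0 ->
  Meet (e @` A) <= Join (e @` B) ->
  exists a b, [/\ A a, B b & a <= b].
Proof.
move=> AI A0 BU B0 /(@ce_compact _ _ X) [A' [B' [A'A fA B'B fB AB]]].
have [a Aa aA] := finite_lower_bound AI A0 fA A'A.
have [b Bb bB] := finite_upper_bound BU B0 fB B'B.
exists a, b; split=> //; rewrite -ce_emb_le.
apply: (le_trans _ (le_trans AB _)).
  by apply: (Meet_glb cX) => _ [x /aA ax <-]; rewrite ce_emb_le.
by apply: (Join_lub cX) => _ [x /bB ax <-]; rewrite ce_emb_le.
Qed.

(** The largest possible witness set works: it contains every other one and still has [x] as a lower
    bound. *)
Lemma filter_elementP (x : X) :
  filter_element e x <-> infimums (e @` [set a | x <= e a]) x.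
Proof.
split=> [[A Ax]|]; last by move=> h; eexists; exact: h.
split; first by move=> _ [a xa <-].
move=> z zlb; apply: Ax.2 => _ [a Aa <-]; apply: zlb; exists a => //=.
by apply: Ax.1; exists a.
Qed.

Lemma ideal_elementP (y : X) :
  ideal_element e y <-> supremums (e @` [set a | e a <= y]) y.
Proof.
split=> [[A Ax]|]; last by move=> h; eexists; exact: h.
split; first by move=> _ [a xa <-].
move=> z zlb; apply: Ax.2 => _ [a Aa <-]; apply: zlb; exists a => //=.
by apply: Ax.1; exists a.
Qed.

Lemma interpolation (x y : X) : filter_element e x -> ideal_element e y ->
  x <= y -> exists a, x <= e a <= y.
Proof.
move=> /filter_elementP fx /ideal_elementP iy xy.
have [eI eU e0 e1] := ehom.
have [|||||a [b [xa yb ab]]] := @ce_compact_directed [set a | x <= e a] [set b | e b <= y].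
- by move=> a b /= xa xb; rewrite eI lexI xa.
- by exists \top; rewrite /= e1 lex1.
- by move=> a b /= xa xb; rewrite eU leUx xa.
- by exists \bot; rewrite /= e0 le0x.
- by rewrite (infimums_eq (infimums_Meet cX _) fx)
    (supremums_eq (supremums_Join cX _) iy).
by exists a; rewrite xa /=; apply: le_trans yb; rewrite ce_emb_le.
Qed.

Lemma le_filter_elements (u v : X) :
  (forall x, filter_element e x -> x <= u -> x <= v) -> u <= v.
Proof.
have [[F Ff Fu] _] := @ce_dense _ _ X u; move=> h; apply: Fu.2 => x Fx.
by apply: h; [exact: Ff|exact: Fu.1].
Qed.

Lemma le_ideal_elements (u v : X) :
  (forall y, ideal_element e y -> v <= y -> u <= y) -> u <= v.
Proof.
have [_ [F Ff Fu]] := @ce_dense _ _ X v; move=> h; apply: Fu.2 => x Fx.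
by apply: h; [exact: Ff|exact: Fu.1].
Qed.

Lemma filter_element_emb a : filter_element e (e a).
Proof. by exists [set a]; rewrite image_set1 infimums1. Qed.

Lemma ideal_element_emb a : ideal_element e (e a).
Proof. by exists [set a]; rewrite image_set1 supremums1. Qed.

(** By density the join can be tested against ideal elements [y] above it. Interpolating [a] and
    [a'] below [y] makes [a | a'] an element of the lattice between the join and [y]. *)
Lemma filter_element_join x x' :
  filter_element e x -> filter_element e x' -> filter_element e (x `|` x').
Proof.
move=> fx fx'; exists [set a | x `|` x' <= e a]; split; first by move=> _ [a ? <-].
move=> z zlb; apply: le_ideal_elements => y iy; rewrite leUx => /andP [xy x'y].
have [a /andP [xa ay]] := interpolation fx iy xy.
have [a' /andP [xa' ay']] := interpolation fx' iy x'y.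
have [_ eU _ _] := ehom.
apply: (@le_trans _ _ (e (a `|` a'))); last by rewrite eU leUx ay.
by apply: zlb; exists (a `|` a') => //=; rewrite eU leU2.
Qed.

Lemma ideal_element_meet x x' :
  ideal_element e x -> ideal_element e x' -> ideal_element e (x `&` x').
Proof.
move=> fx fx'; exists [set a | e a <= x `&` x']; split; first by move=> _ [a ? <-].
move=> z zub; apply: le_filter_elements => y iy; rewrite lexI => /andP [xy x'y].
have [a /andP [xa ay]] := interpolation iy fx xy.
have [a' /andP [xa' ay']] := interpolation iy fx' x'y.
have [eI _ _ _] := ehom.
apply: (@le_trans _ _ (e (a `&` a'))); first by rewrite eI lexI xa.
by apply: zub; exists (a `&` a') => //=; rewrite eI leI2.
Qed.

Lemma tnth_filter_element n (x : n.-tupleprod X) j :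
  filter_element (power_emb X n) x -> filter_element e (tnth x j).
Proof.
move=> [A Ax]; exists [set tnth t j | t in A]; split.
  move=> _ [_ [t At <-] <-]; have := Ax.1 _ (imageP (power_emb X n) At).
  by rewrite leEtprod => /forallP /(_ j); rewrite tnth_map.
move=> z zlb.
(* Replacing only coordinate [j] by [z] keeps a lower bound of the tuples, so it lies below their
   infimum [x]. *)
have : (tuple_upd x j z : n.-tupleprod X) <= x.
  apply: Ax.2 => _ [t At <-]; rewrite leEtprod; apply/forallP => i.
  rewrite tnth_mktuple tnth_map; case: eqP => [->|_].
    by apply: zlb; exists (tnth t j) => //; exists t.
  have := Ax.1 _ (imageP (power_emb X n) At).
  by rewrite leEtprod => /forallP /(_ i); rewrite tnth_map.
by rewrite leEtprod => /forallP /(_ j); rewrite tnth_mktuple eqxx.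
Qed.

Lemma tnth_ideal_element n (x : n.-tupleprod X) j :
  ideal_element (power_emb X n) x -> ideal_element e (tnth x j).
Proof.
move=> [A Ax]; exists [set tnth t j | t in A]; split.
  move=> _ [_ [t At <-] <-]; have := Ax.1 _ (imageP (power_emb X n) At).
  by rewrite leEtprod => /forallP /(_ j); rewrite tnth_map.
move=> z zlb.
have : x <= (tuple_upd x j z : n.-tupleprod X).
  apply: Ax.2 => _ [t At <-]; rewrite leEtprod; apply/forallP => i.
  rewrite tnth_mktuple tnth_map; case: eqP => [->|_].
    by apply: zlb; exists (tnth t j) => //; exists t.
  have := Ax.1 _ (imageP (power_emb X n) At).
  by rewrite leEtprod => /forallP /(_ i); rewrite tnth_map.
by rewrite leEtprod => /forallP /(_ j); rewrite tnth_mktuple eqxx.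
Qed.

Lemma filter_element_tuple n (x : n.-tupleprod X) :
  (forall j, filter_element e (tnth x j)) -> filter_element (power_emb X n) x.
Proof.
move=> fx; exists [set t | x <= power_emb X n t]; split; first by move=> _ [t ? <-].
move=> z zlb; rewrite leEtprod; apply/forallP => j.
have /filter_elementP xj := fx j; apply: xj.2 => _ [a xa <-].
(* With [\top] elsewhere, only coordinate [j] imposes a condition. *)
have := zlb (power_emb X n (tuple_upd [tuple \top | i < n] j a)).
rewrite leEtprod => /(_ _)/forallP/(_ j); rewrite tnth_map tnth_mktuple eqxx.
apply; eexists; last by [].
rewrite /= leEtprod; apply/forallP => i; rewrite tnth_map !tnth_mktuple.
have [_ _ _ e1] := ehom.
by case: eqP => [->|_] //; rewrite [X in _ <= X]e1 lex1.
Qed.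

Lemma ideal_element_tuple n (x : n.-tupleprod X) :
  (forall j, ideal_element e (tnth x j)) -> ideal_element (power_emb X n) x.
Proof.
move=> fx; exists [set t | power_emb X n t <= x]; split; first by move=> _ [t ? <-].
move=> z zlb; rewrite leEtprod; apply/forallP => j.
have /ideal_elementP xj := fx j; apply: xj.2 => _ [a xa <-].
have := zlb (power_emb X n (tuple_upd [tuple \bot | i < n] j a)).
rewrite leEtprod => /(_ _)/forallP/(_ j); rewrite tnth_map tnth_mktuple eqxx.
apply; eexists; last by [].
rewrite /= leEtprod; apply/forallP => i; rewrite tnth_map !tnth_mktuple.
have [_ _ e0 _] := ehom.
by case: eqP => [->|_] //; rewrite [X in X <= _]e0 le0x.
Qed.

End CanonicalExtension.

(** One interval around [u] with all values in [p, q] bounds the sigma extension below and the pi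
    extension above; a value in [p, q] inside every such interval gives the other two bounds. *)
Lemma extensions_in_interval d1 d2 d3 d4 (L : tbLatticeType d1)
    (C : tbLatticeType d2) (M : tbLatticeType d3) (D : tbLatticeType d4)
    (e : L -> C) (e' : M -> D) (f : L -> M) (u : C) (p q : D) :
  complete_lattice D ->
  (exists x y, [/\ filter_element e x, ideal_element e y, x <= u <= y &
     forall b, x <= e b <= y -> p <= e' (f b) <= q]) ->
  (forall x y, filter_element e x -> ideal_element e y -> x <= u <= y ->
     exists2 b, x <= e b <= y & p <= e' (f b) <= q) ->
  p <= sigma_ext e e' f u <= q /\ p <= pi_ext e e' f u <= q.
Proof.
move=> cD [x [y [fx iy xuy fb]]] all_b; split; apply/andP; split.
- apply: (@le_trans _ _ (Meet (interval_image e e' f x y))).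
    by apply: (Meet_glb cD) => _ [b /fb /andP [] pb _ <-].
  by apply: (Join_ub cD); exists (x, y).
- apply: (Join_lub cD) => _ [[x' y'] [/= fx' iy' xuy'] <-].
  have [b xby /andP [_]] := all_b _ _ fx' iy' xuy'.
  by apply: le_trans; apply: (Meet_lb cD); exists b.
- apply: (Meet_glb cD) => _ [[x' y'] [/= fx' iy' xuy'] <-].
  have [b xby /andP [pb _]] := all_b _ _ fx' iy' xuy'.
  by apply: le_trans pb _; apply: (Join_ub cD); exists b.
- apply: (@le_trans _ _ (Join (interval_image e e' f x y))).
    by apply: (Meet_lb cD); exists (x, y).
  by apply: (Join_lub cD) => _ [b /fb /andP [] _ bq <-].
Qed.

(** Otherwise elements unrelated to all earlier ones can be chosen forever, and the first [N.+1] of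
    them contradict the index bound. *)
Lemma index_le_representatives (T : eqType) N (R : T -> T -> Prop) :
  (forall x, R x x) -> (forall x y, R x y -> R y x) -> index_le N R ->
  exists l : seq T, forall x, exists c, c \in l /\ R c x.
Proof.
move=> Rr Rs iR; apply: contrapT => nl.
have [f fP] : {f : seq T -> T & forall l c, c \in l -> ~ R c (f l)}.
  apply: (@choice _ _ (fun l x => forall c, c \in l -> ~ R c x)) => l.
  apply: contrapT => nx; apply: nl; exists l => x; apply: contrapT => nc.
  by apply: nx; exists x => c cl Rcx; apply: nc; exists c.
pose g := fix g n : seq T := if n is m.+1 then f (g m) :: g m else [::].
have gin m n : (m < n)%N -> f (g m) \in g n.
  elim: n => // n IH; rewrite ltnS leq_eqVlt inE => /orP [/eqP ->|/IH ->].
    by rewrite eqxx.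
  by rewrite orbT.
have [i [j [ij Rij]]] := iR (fun i : 'I_N.+1 => f (g i)).
have {ij} := ij; rewrite -(inj_eq val_inj) neq_ltn => /orP [] /gin /fP; apply => //.
exact: Rs.
Qed.

(** * The blocks of a congruence in the canonical extension *)

Section Classes.
Context {S : signature} {E : latticeExpansion S}.
Variable X : canonicalExtension E.
Let e : E -> X := @ce_emb _ E X.
Let cX := @ce_complete _ _ X.
Let ehom : bounded_lattice_hom e := ce_emb_hom X.
Variable R : E -> E -> Prop.

Definition class_inf (a : E) : X := Meet (e @` [set b | R a b]).
Definition class_sup (a : E) : X := Join (e @` [set b | R a b]).

(* The extension of a finite-index congruence to [X]: its blocks are the
   intervals [class_inf a, class_sup a]. *)
Definition in_class (u : X) (a : E) : bool := class_inf a <= u <= class_sup a.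

Hypothesis cR : congruence R.
Let Rr := con_refl cR.
Let Rs := con_sym cR.
Let Rt := con_trans cR.

Lemma filter_element_class_inf a : filter_element e (class_inf a).
Proof. by eexists; exact: infimums_Meet. Qed.

Lemma ideal_element_class_sup a : ideal_element e (class_sup a).
Proof. by eexists; exact: supremums_Join. Qed.

Lemma in_class_emb a b : R a b -> in_class (e b) a.
Proof.
by move=> ab; rewrite /in_class Meet_lb //= ?Join_ub //; exists b.
Qed.

(** Classes are closed under meets and joins, so compactness yields congruent copies of [a] and [b]
    that are comparable. *)
Lemma class_inf_le_sup a b : class_inf a <= class_sup b -> le_mod R a b.
Proof.
move=> /ce_compact_directed [||||a' [b' [/= aa bb ab]]].
- move=> x y /= ax ay; rewrite -[a]meetxx; exact: con_meet.
- by exists a.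
- move=> x y /= ax ay; rewrite -[b]joinxx; exact: con_join.
- by exists b.
apply: (le_mod_trans cR (con_le_modW cR aa)).
exact: (le_mod_trans cR (con_le_mod cR ab) (con_le_modW cR (Rs bb))).
Qed.

Lemma le_in_class u v a b :
  in_class u a -> in_class v b -> u <= v -> le_mod R a b.
Proof.
move=> /andP [au _] /andP [_ vb] uv.
exact/class_inf_le_sup/(le_trans au)/(le_trans uv).
Qed.

Lemma in_class_unique u a b : in_class u a -> in_class u b -> R a b.
Proof.
move=> ua ub; apply: le_mod_antisym => //; first exact: le_in_class ua ub _.
exact: le_in_class ub ua _.
Qed.

Lemma in_class_con u a b : R a b -> in_class u a = in_class u b.
Proof.
move=> ab; rewrite /in_class /class_inf /class_sup.
have -> : [set c | R a c] = [set c | R b c] => //.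
apply/seteqP; split=> c /=; first exact/Rt/Rs.
exact: Rt ab.
Qed.

Lemma in_class_emb_eq a b : in_class (e b) a -> R a b.
Proof. by move=> ba; apply: in_class_unique ba _; apply: in_class_emb. Qed.

(** Interpolation is applied to the interval [x, y] intersected with the block of [a]; the ends of
    this intersection are again a filter and an ideal element. *)
Lemma in_class_interpolation u a (x y : X) :
  in_class u a -> filter_element e x -> ideal_element e y -> x <= u <= y ->
  exists2 b, x <= e b <= y & R a b.
Proof.
move=> /andP [au ua] fx iy /andP [xu uy].
have [||| b] := @interpolation _ _ X (x `|` class_inf a) (y `&` class_sup a).
- exact/filter_element_join/filter_element_class_inf.
- exact/ideal_element_meet/ideal_element_class_sup.
- by rewrite leUx !lexI (le_trans xu uy) (le_trans xu ua) (le_trans au uy) (le_trans au ua).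
rewrite leUx lexI => /andP [/andP [xb ab] /andP [yb ba]].
by exists b; [rewrite xb|apply: in_class_emb_eq; rewrite /in_class ab].
Qed.

Variable N : nat.
Hypothesis iR : index_le N R.

(** Some class must meet every filter-ideal interval around [u]: if each of the finitely many
    classes missed one, the intersection of those intervals would contain no element of the lattice,
    against interpolation. The block of that class contains [u] by density. *)
Lemma in_class_exists u : exists a, in_class u a.
Proof.
pose D x y := [/\ filter_element e x, ideal_element e y & x <= u <= y].
pose Q c x y := exists2 b, x <= e b <= y & R c b.
have [l lP] := index_le_representatives Rr Rs iR.
suff [c cP] : exists c, forall x y, D x y -> Q c x y.
  exists c; apply/andP; split.
    (* With the trivial lower end [e \bot], some member of the class of [c] lies below [y], so
       [class_inf c] does too. *)
    apply: le_ideal_elements => y iy uy.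
    have [|b /andP [_ bY] cb] := cP (e \bot) y.
      split=> //; first exact: filter_element_emb.
      by have [_ _ -> _] := ehom; rewrite le0x.
    by apply: le_trans bY; apply: (Meet_lb cX); exists b.
  apply: le_filter_elements => x fx xu.
  have [|b /andP [xb _] cb] := cP x (e \top).
    split=> //; first exact: ideal_element_emb.
    by have [_ _ _ ->] := ehom; rewrite lex1 xu.
  by apply: le_trans xb _; apply: (Join_ub cX); exists b.
have [//|[x [y [[fx iy /andP [xu uy]] nQ]]]] : (exists c, forall x y, D x y -> Q c x y) \/
    exists x y, D x y /\ forall c, c \in l -> ~ Q c x y; last first.
  have [b xby] := interpolation fx iy (le_trans xu uy).
  have [c [cl Rcb]] := lP b.
  by case: (nQ c cl); exists b.
elim: l {lP} => [|c l [|[x [y [[fx iy /andP [xu uy]] nQ]]]]].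
- right; exists (e \bot), (e \top); split=> //.
  have [_ _ e0 e1] := ehom.
  split; [exact: filter_element_emb|exact: ideal_element_emb|].
  by rewrite e0 e1 le0x lex1.
- by left.
have [cD|] := pselect (forall x y, D x y -> Q c x y); first by left; exists c.
move=> /existsNP [x' /existsNP [y' /not_implyP [[fx' iy' /andP [xu' uy']] nQ']]].
right; exists (x `|` x'), (y `&` y'); split.
  split; [exact: filter_element_join|exact: ideal_element_meet|].
  by rewrite leUx xu xu' lexI uy uy'.
move=> c' cl [b]; rewrite leUx lexI => /andP [/andP [xb xb'] /andP [yb yb']] Rcb.
move: cl; rewrite inE => /orP [/eqP cc|/nQ]; last by apply; exists b; rewrite ?xb.
by apply: nQ'; rewrite -cc; exists b; rewrite ?xb'.
Qed.

Lemma class_inf_le_mod a b : le_mod R a b -> class_inf a <= class_inf b.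
Proof.
move=> ab; apply: (Meet_glb cX) => _ [b' /= bb' <-].
(* As [b'] is congruent to [b], the meet of [a] and [b'] is in the class of [a]. *)
apply: (@le_trans _ _ (e (a `&` b'))); last by rewrite ce_emb_le leIr.
apply: (Meet_lb cX); exists (a `&` b') => //=.
by apply: Rt (Rs ab) _; apply: con_meet.
Qed.

Lemma class_sup_le_mod a b : le_mod R a b -> class_sup a <= class_sup b.
Proof.
move=> /(le_mod_join cR) ab; apply: (Join_lub cX) => _ [a' /= aa' <-].
apply: (@le_trans _ _ (e (a' `|` b))); first by rewrite ce_emb_le leUl.
apply: (Join_ub cX); exists (a' `|` b) => //=.
by apply: Rt (Rs ab) _; apply: con_join.
Qed.

(** Hence the principal up-set of [class_inf a] is a union of blocks. *)
Lemma class_inf_le u a b : in_class u b -> (class_inf a <= u) <-> le_mod R a b.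
Proof.
move=> /andP [bu ub]; split=> [au|/class_inf_le_mod ab]; last exact: le_trans bu.
exact/class_inf_le_sup/(le_trans au).
Qed.

Lemma class_sup_ge u a b : in_class u b -> (u <= class_sup a) <-> le_mod R b a.
Proof.
move=> /andP [bu ub]; split=> [au|/class_sup_le_mod ab]; last exact: le_trans ab.
exact/class_inf_le_sup/(le_trans bu).
Qed.

(** The block of the meet exists by covering; order modulo [R] then identifies its class [c] with
    that of [a & b]. *)
Lemma in_class_meet u v a b :
  in_class u a -> in_class v b -> in_class (u `&` v) (a `&` b).
Proof.
move=> ua vb; have [c uvc] := in_class_exists (u `&` v).
rewrite (in_class_con _ (b := c)) //; apply: le_mod_antisym => //.
  apply/(class_inf_le _ uvc); rewrite lexI.
  apply/andP; split.
    by apply/(class_inf_le _ ua)/(con_le_mod cR)/leIl.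
  by apply/(class_inf_le _ vb)/(con_le_mod cR)/leIr.
apply: le_mod_meet => //; first exact: le_in_class uvc ua (leIl _ _).
exact: le_in_class uvc vb (leIr _ _).
Qed.

Lemma in_class_join u v a b :
  in_class u a -> in_class v b -> in_class (u `|` v) (a `|` b).
Proof.
move=> ua vb; have [c uvc] := in_class_exists (u `|` v).
rewrite (in_class_con _ (b := c)) //; apply: le_mod_antisym => //.
  apply: le_mod_lub => //; first exact: le_in_class ua uvc (leUl _ _).
  exact: le_in_class vb uvc (leUr _ _).
apply/(class_sup_ge _ uvc); rewrite leUx.
apply/andP; split.
  by apply/(class_sup_ge _ ua)/(con_le_mod cR)/leUl.
by apply/(class_sup_ge _ vb)/(con_le_mod cR)/leUr.
Qed.

(** The box of blocks around [u] is an interval on which all values of [f] lie in the block of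
    [f t]. In any other interval, interpolation in each coordinate produces a tuple congruent to
    [t]. *)
Lemma in_class_extension n (f : n.-tuple E -> E) (u : n.-tupleprod X)
    (t : n.-tuple E) :
  (forall t', (forall j, R (tnth t j) (tnth t' j)) -> R (f t) (f t')) ->
  (forall j, in_class (tnth u j) (tnth t j)) ->
  in_class (delta_op X f u) (f t) /\
  in_class (pi_ext (power_emb X n) e f u) (f t).
Proof.
move=> fR ut; apply: extensions_in_interval => //.
  exists [tuple class_inf (tnth t j) | j < n], [tuple class_sup (tnth t j) | j < n].
  split.
  - apply: filter_element_tuple => j; rewrite tnth_mktuple.
    exact: filter_element_class_inf.
  - apply: ideal_element_tuple => j; rewrite tnth_mktuple.
    exact: ideal_element_class_sup.
  - rewrite !leEtprod; apply/andP; split; apply/forallP => j; rewrite tnth_mktuple;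
    by have /andP [] := ut j.
  move=> t'; rewrite !leEtprod => /andP [/forallP l /forallP r].
  apply/in_class_emb/fR => j; apply: in_class_emb_eq.
  by have := l j; have := r j; rewrite !tnth_mktuple !tnth_map /in_class => -> ->.
move=> x y fx iy; rewrite !leEtprod => /andP [/forallP xu /forallP uy].
have /choice [g gP] j : exists b, (tnth x j <= e b <= tnth y j) /\ R (tnth t j) b.
  have [||| b ? ?] := @in_class_interpolation _ _ (tnth x j) (tnth y j) (ut j).
  - exact: tnth_filter_element.
  - exact: tnth_ideal_element.
  - by rewrite xu uy.
  - by exists b.
exists [tuple g j | j < n]; last first.
  by apply/in_class_emb/fR => j; rewrite tnth_mktuple; have [] := gP j.
rewrite !leEtprod; apply/andP; split; apply/forallP => j;
  by rewrite tnth_map tnth_mktuple; have [/andP []] := gP j.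
Qed.

(** The lattice operations here are those of [X] itself, not sigma extensions, and so are treated
    separately. *)
Lemma in_class_basic_op (s : basicSym S) (u : (basic_arity s).-tuple X)
    (t : (basic_arity s).-tuple E) :
  (forall j, in_class (tnth u j) (tnth t j)) ->
  in_class (@basic_op S (canext X) s u) (basic_op t).
Proof.
have [_ _ e0 e1] := ehom.
case: s u t => [||||f] u t ut /=.
- exact: in_class_meet.
- exact: in_class_join.
- by have := in_class_emb (Rr \bot); rewrite e0.
- by have := in_class_emb (Rr \top); rewrite e1.
- by have [] := in_class_extension (con_op cR (s := AddSym f) (t := t)) ut.
Qed.

End Classes.

(** * Blocks determine the order of the canonical extension *)

Section Separation.
Context {S : signature} {E : latticeExpansion S}.
Variable X : canonicalExtension E.
Variable N : nat.
Hypothesis resE : residually_index_le N E.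

(** Density gives a filter element [x <= u] and an ideal element [y >= v] with [x] not below [y].
    Then the filter above [x] and the ideal below [y] can be separated by a congruence of bounded
    index. *)
Lemma in_class_separation (u v : X) : ~ u <= v ->
  exists R, [/\ congruence R, index_le N R & forall a b,
     in_class R u a -> in_class R v b -> ~ le_mod R a b].
Proof.
move=> uv; have [eI eU e0 e1] := ce_emb_hom X.
have [x [fx xu xv]] : exists x, [/\ filter_element (@ce_emb _ E X) x, x <= u & ~ x <= v].
  apply: contrapT => h; apply/uv/(@le_filter_elements _ _ X) => x fx xu.
  by apply: contrapT => xv; apply: h; exists x.
have [y [iy vy xy]] : exists y, [/\ ideal_element (@ce_emb _ E X) y, v <= y & ~ x <= y].
  apply: contrapT => h; apply/xv/(@le_ideal_elements _ _ X) => y iy vy.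
  by apply: contrapT => xy; apply: h; exists y.
pose F := [set a | x <= ce_emb X a]; pose I := [set b | ce_emb X b <= y].
have FI a b : F a -> F b -> F (a `&` b) by rewrite /F /= eI lexI => -> ->.
have IU a b : I a -> I b -> I (a `|` b) by rewrite /I /= eU leUx => -> ->.
have sE : separates_mod F I (@eq E).
  move=> a b /= Fa Ib /meet_idPl; rewrite -(ce_emb_le X) => ab.
  exact/xy/(le_trans Fa)/(le_trans ab).
have [||R [cR iR sR _]] := separating_index_le FI IU resE _ _ (congruence_eq E) sE.
- by exists \top; rewrite /F /= e1 lex1.
- by exists \bot; rewrite /I /= e0 le0x.
exists R; split=> // a b ua vb ab.
(* The classes of [x] and [y] contain some [c] in [F] and [d] in [I]; an inequality between the
   classes of [u] and [v] would put [c] below [d] modulo [R]. *)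
have [a' xa'] := in_class_exists cR iR x; have [b' yb'] := in_class_exists cR iR y.
have [|c /andP [xc _] Rc] := in_class_interpolation cR xa' fx (ideal_element_emb X \top).
  by rewrite lexx e1 lex1.
have [|d /andP [_ dy] Rd] := in_class_interpolation cR yb' (filter_element_emb X \bot) iy.
  by rewrite lexx e0 le0x.
apply: (sR c d) => //.
apply: (le_mod_trans cR (con_le_modW cR (con_sym cR Rc))).
apply: (le_mod_trans cR (le_in_class cR xa' ua xu)).
apply: (le_mod_trans cR ab); apply: (le_mod_trans cR (le_in_class cR vb yb' vy)).
exact: con_le_modW.
Qed.

End Separation.

(** * Interval and double Scott topologies *)

Lemma open_generated (T : choiceType) (B : set (set T)) (U : set T) :
  B U -> open (U : set (generated_space B)).
Proof.
move=> BU; exists [set U]; last by rewrite bigcup_set1.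
by move=> _ ->; apply: (@finI_from1 _ _ B id).
Qed.

Lemma cvg_generated (T : choiceType) (B : set (set T))
    (F : set_system (generated_space B)) (x : generated_space B) :
  Filter F -> (forall U : set T, B U -> U x -> F U) -> F --> x.
Proof.
move=> FF BF A; rewrite nbhsE => -[O [[D DB <-] [V DV Vx]] OA].
apply: (filterS OA); have [D' D'B VE] := DB _ DV.
apply: (@filterS _ _ _ V); first by move=> y Vy; exists V.
rewrite -VE; apply: filter_bigI => U UD'; apply: BF; first exact/set_mem/D'B.
by move: Vx; rewrite -VE; apply.
Qed.

Lemma continuous_generated (Y : topologicalType) (T : choiceType)
    (B : set (set T)) (f : Y -> generated_space B) :
  (forall (U : set T) y, B U -> U (f y) -> nbhs y (f @^-1` U)) -> continuous f.
Proof. by move=> h y; apply: cvg_generated => U BU Ufy; apply: h. Qed.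

Lemma generated_open_sub (T : choiceType) (B B' : set (set T)) :
  (forall U, B U -> open (U : set (generated_space B'))) ->
  @open (generated_space B) `<=` @open (generated_space B').
Proof.
move=> BB' U oU.
have /continuousP : continuous (id : generated_space B' -> generated_space B).
  apply: continuous_generated => V y BV Vy.
  by apply: open_nbhs_nbhs; split=> //; exact: BB'.
exact.
Qed.

Section IntervalTopology.
Context {d : Order.disp_t}.

Lemma interval_opens_not_ge (T : porderType d) (a : T) :
  interval_opens T (~` [set x | a <= x])%classic.
Proof. by apply: open_generated; exists a; left. Qed.

Lemma interval_opens_not_le (T : porderType d) (a : T) :
  interval_opens T (~` [set x | x <= a])%classic.
Proof. by apply: open_generated; exists a; right. Qed.

(** An ultrafilter converges to the join of all [a] whose up-set it contains: if it also contains
    the down-set of [b], the two sets intersect, so each such [a], and hence the join, is below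
    [b]. *)
Lemma interval_compact (T : tbLatticeType d) :
  complete_lattice T -> compact [set: interval_space T].
Proof.
move=> cT; rewrite compact_ultra => F FU _.
pose x : T := Join [set a | F [set y | a <= y]].
exists x; split=> //; apply: cvg_generated => _ [a [->|->]] /= ax.
  have [Fa|//] := @in_ultra_setVsetC _ F [set y | a <= y] FU.
  by case: ax; apply: (Join_ub cT).
have [Fa|//] := @in_ultra_setVsetC _ F [set y | y <= a] FU.
case: ax; apply: (Join_lub cT) => b /= Fb.
have [y [/= by_ ya]] := filter_ex (filterI Fb Fa).
exact: le_trans by_ ya.
Qed.

End IntervalTopology.

(** A Priestley-type separation: principal up-sets are closed in the interval topology, so the one
    of [p] is clopen. *)
Definition up_separated d (T : porderType d) : Prop :=
  forall u v : T, ~ u <= v ->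
    exists p, [/\ p <= u, ~ p <= v & interval_opens T [set x | p <= x]].

Definition down_separated d (T : porderType d) : Prop :=
  forall u v : T, ~ u <= v ->
    exists q, [/\ v <= q, ~ u <= q & interval_opens T [set x | x <= q]].

(** The elements below [x] whose up-sets are open form a directed set with supremum [x]. A Scott
    open set around [x] contains one of them, hence its whole open up-set. *)
Lemma scott_open_interval d (T : tbLatticeType d) :
  up_separated T -> @scott_open _ T `<=` interval_opens T.
Proof.
move=> sT U [Uup Usup]; rewrite /interval_opens openE => x Ux.
pose A := [set p | p <= x /\ interval_opens T [set y | p <= y]].
have [||| p [[px op] Up]] := Usup A x.
- split.
    exists \bot; split; first exact: le0x.
    rewrite (_ : mkset _ = setT); first exact: openT.
    by apply/seteqP; split=> y //= _; exact: le0x.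
  move=> p q [px op] [qx oq]; exists (p `|` q); rewrite leUl leUr; split=> //; split.
    by rewrite leUx px.
  rewrite (_ : mkset _ = [set y | p <= y] `&` [set y | q <= y]); first exact: openI.
  by apply/seteqP; split=> y /=; rewrite leUx => /andP.
- split; first by move=> p [].
  move=> z zub; apply: contrapT => /sT [p [px pz op]]; apply: pz; exact: zub.
- by [].
apply: (@filterS _ _ _ [set y | p <= y]); first by move=> y py; exact: Uup py Up.
exact: open_nbhs_nbhs.
Qed.

Lemma interval_subbase_dual d (T : porderType d) :
  @interval_subbase _ T^d = @interval_subbase _ T.
Proof. by apply/seteqP; split=> U [a [->|->]]; exists a; [right|left|right|left]. Qed.

Lemma interval_opens_dual d (T : porderType d) :
  interval_opens (T^d : porderType _) = interval_opens T.
Proof.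
rewrite /interval_opens /interval_space.
have -> : @open (generated_space (@interval_subbase _ T^d)) =
  @open (@generated_space T (@interval_subbase _ T^d)) by [].
by rewrite interval_subbase_dual.
Qed.

Lemma scott_open_not_le d (T : porderType d) (a : T) :
  @scott_open _ T (~` [set x | x <= a])%classic.
Proof.
split=> [x y xy /= xa ya|A s _ As sa]; first exact/xa/(le_trans xy).
apply: contrapT => h; apply/sa/As.2 => x Ax; apply: contrapT => xa.
by apply: h; exists x.
Qed.

Lemma interval_double_scott d (T : tbLatticeType d) :
  up_separated T -> down_separated T ->
  interval_opens T = double_scott_opens T.
Proof.
move=> uT dT; apply/seteqP; split; apply: generated_open_sub => U.
  move=> [a [->|->]]; apply: open_generated; [right|left].
    exact: (@scott_open_not_le _ T^d).
  exact: scott_open_not_le.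
case; first exact: scott_open_interval.
move=> sU; rewrite -[open _]/(interval_opens T U) -interval_opens_dual.
apply: (@scott_open_interval _ T^d) => // u v /dT [q [vq uq oq]].
by exists q; split=> //; rewrite interval_opens_dual.
Qed.

Section Separated.
Context {d : Order.disp_t} {T : porderType d}.
Hypotheses (uT : up_separated T) (dT : down_separated T).

Lemma clopen_up (p : T) : interval_opens T [set x | p <= x] ->
  clopen ([set x | p <= x] : set (interval_space T)).
Proof. by move=> op; split=> //; rewrite -openC; exact: interval_opens_not_ge. Qed.

Lemma clopen_down (p : T) : interval_opens T [set x | x <= p] ->
  clopen ([set x | x <= p] : set (interval_space T)).
Proof. by move=> op; split=> //; rewrite -openC; exact: interval_opens_not_le. Qed.

Lemma interval_hausdorff : hausdorff_space (interval_space T).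
Proof.
have sep (x y : T) : ~ x <= y -> 
    exists2 U : set (interval_space T), clopen U & U x /\ ~ U y.
  by move=> /uT [p [px py /clopen_up cp]]; exists [set x | p <= x].
have main (x y : interval_space T) : x <> y -> 
    exists2 U : set (interval_space T), clopen U & U x /\ ~ U y.
  move=> xy; have [xley|/sep //] := pselect ((x : T) <= y).
  have [|U [oU cU] [Uy Ux]] := sep y x.
    by move=> yx; apply: xy; apply/le_anti; rewrite xley yx.
  exists (~` U)%classic; last by split=> //= /(_ Uy).
  by split; [rewrite openC|rewrite -openC setCK].
rewrite open_hausdorff => x y /eqP /main [U [oU cU] [Ux Uy]].
exists (U, ~` U)%classic; rewrite ?inE //=; split=> //; first by rewrite openC.
by rewrite setICr.
Qed.

(** The clopen sets around a point generate a filter, so it is enough to refine subbasic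
    neighbourhoods. *)
Lemma interval_clopen_base : has_clopen_base (interval_space T).
Proof.
split; first by move=> U [].
move=> x.
have cF : Filter (filter_from
    [set U : set (interval_space T) | clopen U /\ U x] id).
  apply: filter_from_filter; first by exists setT; split=> //; exact: clopenT.
  move=> U V [cU Ux] [cV Vx]; exists (U `&` V) => //; split=> //.
  exact: clopenI.
apply: cvg_generated => _ [a [->|->]] /= ax.
  have [q [xq aq /clopen_down cq]] := dT ax.
  exists [set y | y <= q] => // y yq; change (~ a <= y) => ay.
  exact/aq/(le_trans ay).
have [q [xq aq /clopen_up cq]] := uT ax.
exists [set y | q <= y] => // y yq; change (~ y <= a) => ay.
exact/aq/(le_trans yq).
Qed.

End Separated.

(** * Finite powers *)

Section Powers.
Context {d : Order.disp_t} {T : tbLatticeType d}.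
Variable n : nat.

(** A principal up-set or down-set in coordinate [j] is principal in the power: the other
    coordinates are [\bot], respectively [\top]. *)
Lemma tnth_continuous j : continuous
  ((fun t => tnth t j) : interval_space (n.-tupleprod T) -> interval_space T).
Proof.
apply: continuous_generated => _ t [a [->|->]] /= aj.
  apply: (@filterS _ _ _ (~` [set t |
      (tuple_upd [tuple \bot | i < n] j a : n.-tupleprod T) <= t])%classic).
    move=> t' h; change (~ a <= tnth t' j) => ajt.
    apply: h => /=; rewrite leEtprod; apply/forallP => i.
    by rewrite !tnth_mktuple; case: eqP => [->|_]; rewrite ?le0x.
  apply: open_nbhs_nbhs; split; first exact: interval_opens_not_ge.
  by rewrite /= leEtprod => /forallP /(_ j); rewrite tnth_mktuple eqxx.
apply: (@filterS _ _ _ (~` [set t |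
    t <= (tuple_upd [tuple \top | i < n] j a : n.-tupleprod T)])%classic).
  move=> t' h; change (~ tnth t' j <= a) => ajt.
    apply: h => /=; rewrite leEtprod; apply/forallP => i.
  by rewrite !tnth_mktuple; case: eqP => [->|_]; rewrite ?lex1.
apply: open_nbhs_nbhs; split; first exact: interval_opens_not_le.
by rewrite /= leEtprod => /forallP /(_ j); rewrite tnth_mktuple eqxx.
Qed.

Lemma up_separated_power : up_separated T -> up_separated (n.-tupleprod T).
Proof.
move=> uT u v; rewrite leEtprod => /negP; rewrite negb_forall => /existsP [j /negP].
move=> /uT [p [pu pv op]]; exists (tuple_upd [tuple \bot | i < n] j p).
have pE (t : n.-tupleprod T) :
    ((tuple_upd [tuple \bot | i < n] j p : n.-tupleprod T) <= t) = (p <= tnth t j).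
  rewrite leEtprod; apply/forallP/idP => [/(_ j)|pt i]; rewrite !tnth_mktuple ?eqxx //.
  by case: eqP => [->|_]; rewrite ?le0x.
rewrite !pE; split=> //.
rewrite (_ : mkset _ = (fun t => tnth t j) @^-1` [set x | p <= x]).
  have /continuousP := @tnth_continuous j; exact.
by apply/seteqP; split=> t /=; rewrite pE.
Qed.

Lemma down_separated_power : down_separated T -> down_separated (n.-tupleprod T).
Proof.
move=> dT u v; rewrite leEtprod => /negP; rewrite negb_forall => /existsP [j /negP].
move=> /dT [p [pu pv op]]; exists (tuple_upd [tuple \top | i < n] j p).
have pE (t : n.-tupleprod T) :
    (t <= (tuple_upd [tuple \top | i < n] j p : n.-tupleprod T)) = (tnth t j <= p).
  rewrite leEtprod; apply/forallP/idP => [/(_ j)|pt i]; rewrite !tnth_mktuple ?eqxx //.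
  by case: eqP => [->|_]; rewrite ?lex1.
rewrite !pE; split=> //.
rewrite (_ : mkset _ = (fun t => tnth t j) @^-1` [set x | x <= p]).
  have /continuousP := @tnth_continuous j; exact.
by apply/seteqP; split=> t /=; rewrite pE.
Qed.

End Powers.

(** * Topology and operations of the canonical extension *)

Section CanonicalTopology.
Context {S : signature} {E : latticeExpansion S}.
Variable X : canonicalExtension E.
Variable N : nat.
Hypothesis resE : residually_index_le N E.
Let cX := @ce_complete _ _ X.

(** The other blocks are finitely many closed intervals, and none of them contains [u]. *)
Lemma in_class_nbhs (R : E -> E -> Prop) (u : interval_space X) a :
  congruence R -> index_le N R -> in_class R u a ->
  nbhs u [set v : interval_space X | in_class R v a].
Proof.
move=> cR iR ua.
have [l lP] := index_le_representatives (con_refl cR) (con_sym cR) iR.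
suff H (s : seq E) : nbhs u [set v : interval_space X |
    forall c, c \in s -> ~ R c a -> ~ in_class R v c].
  apply: filterS (H l) => v /= vl.
  have [b vb] := in_class_exists cR iR v; have [c [cl cb]] := lP b.
  have vc : in_class R v c by rewrite (in_class_con cR _ cb).
  have [ca|/(vl _ cl)//] := pselect (R c a).
  by rewrite -(in_class_con cR _ ca).
elim: s => [|c s IH]; first by apply: filterS filterT.
have [ca|nca] := pselect (R c a).
  apply: filterS IH => v vs c'; rewrite inE => /orP [/eqP -> //|]; exact: vs.
have : ~ in_class R u c by move=> uc; apply/nca/(in_class_unique cR uc ua).
move=> /negP; rewrite negb_and => /orP [] /negP h.
  have := open_nbhs_nbhs (conj (interval_opens_not_ge (class_inf X R c)) h : open_nbhs u _).
  apply: filterS2 IH => v vs vc c'; rewrite inE => /orP [/eqP -> _ /andP [//]|]; exact: vs.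
have := open_nbhs_nbhs (conj (interval_opens_not_le (class_sup X R c)) h : open_nbhs u _).
apply: filterS2 IH => v vs vc c'; rewrite inE => /orP [/eqP -> _ /andP [//]|]; exact: vs.
Qed.

(** A separating congruence supplies [class_inf], whose up-set is a union of open blocks. *)
Lemma ce_up_separated : up_separated X.
Proof.
move=> u v /(in_class_separation resE) [R [cR iR sR]].
have [a ua] := in_class_exists cR iR u; have [b vb] := in_class_exists cR iR v.
exists (class_inf X R a); split; first by have /andP [] := ua.
  by move=> /(class_inf_le cR _ vb); exact: sR.
rewrite /interval_opens openE => w aw; have [c wc] := in_class_exists cR iR w.
apply: filterS (in_class_nbhs cR iR wc) => w' w'c.
by apply/(class_inf_le cR _ w'c)/(class_inf_le cR _ wc).
Qed.

Lemma ce_down_separated : down_separated X.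
Proof.
move=> u v /(in_class_separation resE) [R [cR iR sR]].
have [a ua] := in_class_exists cR iR u; have [b vb] := in_class_exists cR iR v.
exists (class_sup X R b); split; first by have /andP [] := vb.
  by move=> /(class_sup_ge cR _ ua); exact: sR.
rewrite /interval_opens openE => w aw; have [c wc] := in_class_exists cR iR w.
apply: filterS (in_class_nbhs cR iR wc) => w' w'c.
by apply/(class_sup_ge cR _ w'c)/(class_sup_ge cR _ wc).
Qed.

(** Near [y] the value of [g] stays in one block of a congruence that separates [g (p y)] from the
    bound [a]. The map [p] lets the lemma serve both the interval topology of a power and the
    product topology. *)
Lemma in_class_continuous (Y : topologicalType) n (p : Y -> n.-tuple X)
    (g : n.-tuple X -> X) (f : n.-tuple E -> E) :
  (forall j, continuous ((fun y => tnth (p y) j) : Y -> interval_space X)) ->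
  (forall R, congruence R -> index_le N R -> forall u t,
     (forall j, in_class R (tnth u j) (tnth t j)) -> in_class R (g u) (f t)) ->
  continuous ((g \o p) : Y -> interval_space X).
Proof.
move=> pc gf.
have main R y : congruence R -> index_le N R ->
    exists2 b, in_class R (g (p y)) b & nbhs y [set y' | in_class R (g (p y')) b].
  move=> cR iR.
  have /choice [t ut] j := in_class_exists cR iR (tnth (p y) j).
  exists (f [tuple t j | j < n]).
    by apply: gf => // j; rewrite tnth_mktuple.
  have : nbhs y [set y' | forall j, in_class R (tnth (p y') j) (t j)].
    by apply: filter_forall => j; exact: (pc j y _ (in_class_nbhs cR iR (ut j))).
  by apply: filterS => y' h; apply: gf => // j; rewrite tnth_mktuple.
apply: continuous_generated => _ y [a [->|->]] /= ay.
  have [R [cR iR sR]] := in_class_separation resE ay.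
  have [b yb near_b] := main R y cR iR; have [c ac] := in_class_exists cR iR a.
  apply: filterS near_b => y' y'b; change (~ a <= g (p y')) => ay'.
  exact: (sR c b ac yb) (le_in_class cR ac y'b ay').
have [R [cR iR sR]] := in_class_separation resE ay.
have [b yb near_b] := main R y cR iR; have [c ac] := in_class_exists cR iR a.
apply: filterS near_b => y' y'b; change (~ g (p y') <= a) => ay'.
exact: (sR b c yb ac) (le_in_class cR y'b ac ay').
Qed.

Lemma in_class_eq (u v : X) :
  (forall R, congruence R -> index_le N R ->
     exists2 a, in_class R u a & in_class R v a) -> u = v.
Proof.
move=> h; apply/le_anti/andP; split; apply: contrapT;
  move=> /(in_class_separation resE) [R [cR iR sR]]; have [a ua va] := h R cR iR;
  by apply: (sR a a) => //; exact: (con_le_mod cR (lexx a)).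
Qed.

Lemma in_class_eq_op n (g g' : n.-tuple X -> X) (f : n.-tuple E -> E) :
  (forall R, congruence R -> index_le N R -> forall u t,
     (forall j, in_class R (tnth u j) (tnth t j)) ->
     in_class R (g u) (f t) /\ in_class R (g' u) (f t)) ->
  g =1 g'.
Proof.
move=> gg' u; apply: in_class_eq => R cR iR.
have /choice [t ut] j := in_class_exists cR iR (tnth u j).
have [|? ?] := gg' R cR iR u [tuple t j | j < n]; first by move=> j; rewrite tnth_mktuple.
by exists (f [tuple t j | j < n]).
Qed.

Lemma ce_smooth (s : basicSym S) : smooth_op X (@basic_op S E s).
Proof.
apply: (@in_class_eq_op _ _ _ (@basic_op S E s)) => R cR iR u t.
by apply: in_class_extension => // t'; exact: (con_op cR).
Qed.

Lemma ce_interval_double_scott : interval_opens X = double_scott_opens X.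
Proof. exact: interval_double_scott ce_up_separated ce_down_separated. Qed.

Lemma ce_power_interval_double_scott n :
  interval_opens (n.-tupleprod X) = double_scott_opens (n.-tupleprod X).
Proof.
apply: interval_double_scott; first exact/up_separated_power/ce_up_separated.
exact/down_separated_power/ce_down_separated.
Qed.

Lemma ce_delta_op_continuous (s : basicSym S) :
  interval_continuous (delta_op X (@basic_op S E s)).
Proof.
apply: (@in_class_continuous (interval_space (_.-tupleprod X)) _ id
  (delta_op X (@basic_op S E s)) (@basic_op S E s)).
  by move=> j; exact: tnth_continuous.
move=> R cR iR u t ut.
by have [] := in_class_extension cR (con_op cR (t := t)) ut.
Qed.

Lemma ce_stone : stone_topological_algebra (T := interval_space X)
  (@basic_op S (canext X)).
Proof.
split.
- exact: interval_compact.
- exact: interval_hausdorff ce_up_separated.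
- exact: interval_clopen_base ce_up_separated ce_down_separated.
- move=> s; apply: (@in_class_continuous _ _ _ _ (@basic_op S E s)).
    move=> j; rewrite (_ : (fun=> _) = fun v => v j).
      exact: (@proj_continuous _ (fun=> interval_space X) j).
    by apply/funext => v; rewrite tnth_mktuple.
  by move=> R cR iR u t; exact: in_class_basic_op.
Qed.

End CanonicalTopology.

(** * Functoriality *)

Section Functoriality.
Context {S : signature} {E E' : latticeExpansion S}.
Variables (X : canonicalExtension E) (X' : canonicalExtension E').
Variable h : E -> E'.
Hypothesis hh : homomorphism h.

(** On the whole block of [a] for the pulled-back congruence, [h] takes values in the block of
    [h a]; the squeeze used for operations applies again. *)
Lemma in_class_delta_map (R : E' -> E' -> Prop) u a : congruence R ->
  in_class (fun x y => R (h x) (h y)) u a ->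
  in_class R (delta_map X X' h u) (h a).
Proof.
move=> cR; pose R' x y := R (h x) (h y); rewrite -/R' => ua.
have cR' : congruence R' := con_preim hh cR.
have [|||//] := @extensions_in_interval _ _ _ _ _ _ _ _
  (@ce_emb _ _ X) (@ce_emb _ _ X') h u
  (class_inf X' R (h a)) (class_sup X' R (h a)).
- exact: ce_complete.
- exists (class_inf X R' a), (class_sup X R' a); split=> //.
  + exact: filter_element_class_inf.
  + exact: ideal_element_class_sup.
  + by move=> b /(in_class_emb_eq cR') ab; apply: in_class_emb.
move=> x y fx iy xuy.
have [b xby ab] := in_class_interpolation cR' ua fx iy xuy.
by exists b => //; apply: in_class_emb.
Qed.

Variable N : nat.
Hypothesis resE' : residually_index_le N E'.

Lemma delta_map_homomorphism :
  homomorphism (delta_map X X' h : canext X -> canext X').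
Proof.
suff H (s : basicSym S) (u : (basic_arity s).-tuple X) :
    delta_map X X' h (@basic_op S (canext X) s u) =
    @basic_op S (canext X') s (map_tuple (delta_map X X' h) u).
  split; last by move=> f u; exact: (H (AddSym f) u).
  split.
  - by move=> x y; have := H MeetSym [tuple x; y].
  - by move=> x y; have := H JoinSym [tuple x; y].
  - exact: (H BotSym [tuple]).
  - exact: (H TopSym [tuple]).
(* Points of [X'] are compared modulo congruences of [E']; pulled back along [h], these keep their
   index bound, so representatives [t] exist in [E]. *)
apply: (in_class_eq resE') => R cR iR; pose R' x y := R (h x) (h y).
have cR' : congruence R' := con_preim hh cR.
have iR' : index_le N R' := index_le_preim h iR.
have /choice [t ut] j := in_class_exists cR' iR' (tnth u j).
exists (h (basic_op [tuple t j | j < basic_arity s])).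
  apply: in_class_delta_map => //; apply: in_class_basic_op iR' _ _ _ _ => // j.
  by rewrite tnth_mktuple.
rewrite (hom_basic_op _ hh); apply: (in_class_basic_op cR iR) => j.
by rewrite !tnth_map tnth_ord_tuple; exact: in_class_delta_map.
Qed.

End Functoriality.

Lemma delta_map_id (S : signature) (E : latticeExpansion S)
    (X : canonicalExtension E) N :
  residually_index_le N E -> delta_map X X id = id.
Proof.
move=> resE; apply/funext => u; apply: (in_class_eq resE) => R cR iR.
have [a ua] := in_class_exists cR iR u; exists a => //.
apply: in_class_delta_map => //; split=> // f t; congr op.
by apply: eq_from_tnth => j; rewrite tnth_map.
Qed.

Lemma homomorphism_comp (S : signature) (E E' E'' : latticeExpansion S)
    (h : E -> E') (h' : E' -> E'') :
  homomorphism h -> homomorphism h' -> homomorphism (h' \o h).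
Proof.
move=> [[hI hU h0 h1] hop] [[hI' hU' h0' h1'] hop']; split.
  by split=> [x y|x y||] /=; rewrite ?hI ?hU ?h0 ?h1.
move=> f t; rewrite /= hop hop'; congr op.
by apply: eq_from_tnth => j; rewrite !tnth_map.
Qed.

Lemma delta_map_comp (S : signature) (E E' E'' : latticeExpansion S)
    (h : E -> E') (h' : E' -> E'') (X : canonicalExtension E)
    (X' : canonicalExtension E') (X'' : canonicalExtension E'') N :
  homomorphism h -> homomorphism h' -> residually_index_le N E'' ->
  delta_map X X'' (h' \o h) = delta_map X' X'' h' \o delta_map X X' h.
Proof.
move=> hh hh' resE; apply/funext => u; apply: (in_class_eq resE) => R cR iR.
have hhh := homomorphism_comp hh hh'.
have [a ua] := in_class_exists (con_preim hhh cR) (index_le_preim (h' \o h) iR) u.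
(* Both maps send [u] into the block of this element, one directly and the other through the block
   of [h a] in [X']. *)
exists (h' (h a)); first exact: (in_class_delta_map _ hhh).
apply: in_class_delta_map => //; apply: in_class_delta_map => //.
exact: con_preim.
Qed.

Theorem theorem6 (S : signature) (k : nat) (K : 'I_k -> latticeExpansion S)
    (finK : forall i : 'I_k, finite_set (@setT (K i))) :
  let V : latticeExpansion S -> Prop := generated_variety K in
  [/\ (* every basic operation is smooth *)
      (forall (E : latticeExpansion S), V E ->
        forall (X : canonicalExtension E) (s : basicSym S),
          smooth_op X (@basic_op S E s)),
      (* continuity in the interval = double Scott topology *)
      (forall (E : latticeExpansion S), V E ->
        forall X : canonicalExtension E,
          [/\ interval_opens X = double_scott_opens X,
              (forall n : nat,
                 interval_opens (n.-tupleprod X) =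
                 double_scott_opens (n.-tupleprod X)) &
              (forall s : basicSym S,
                 interval_continuous (delta_op X (@basic_op S E s)))]),
      (* functoriality *)
      [/\ (forall (E E' : latticeExpansion S) (h : E -> E'),
             V E -> V E' -> homomorphism h ->
             forall (X : canonicalExtension E) (X' : canonicalExtension E'),
               homomorphism (delta_map X X' h : canext X -> canext X')),
          (forall (E : latticeExpansion S), V E ->
             forall X : canonicalExtension E, delta_map X X id = id) &
          (forall (E E' E'' : latticeExpansion S) (h : E -> E') (h' : E' -> E''),
             V E -> V E' -> V E'' -> homomorphism h -> homomorphism h' ->
             forall (X : canonicalExtension E) (X' : canonicalExtension E')
               (X'' : canonicalExtension E''),
               delta_map X X'' (h' \o h) = delta_map X' X'' h' \o delta_map X X' h)] &
      (* Stone topological algebras *)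
      (forall (E : latticeExpansion S), V E ->
        forall X : canonicalExtension E,
          stone_topological_algebra (T := interval_space X)
            (@basic_op S (canext X)))].
Proof.
have [N resV] := generated_residually_index_le finK.
move=> V; split.
- by move=> E /resV resE X s; exact: (ce_smooth resE).
- move=> E /resV resE X; split.
  + exact: (ce_interval_double_scott X resE).
  + by move=> n; exact: (ce_power_interval_double_scott X resE).
  + by move=> s; exact: (ce_delta_op_continuous resE).
- split.
  + move=> E E' h _ /resV resE' hh X X'; exact: (delta_map_homomorphism X X' hh resE').
  + by move=> E /resV resE X; exact: (delta_map_id X resE).
  + move=> E E' E'' h h' _ _ /resV resE hh hh' X X' X''.
    exact: (delta_map_comp X X' X'' hh hh' resE).
- by move=> E /resV resE X; exact: (ce_stone X resE).
Qed.
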